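(* Let $X=\{1,2,3,4,5,6\}$ be the involutory connected quandle of order $6$ whose right multiplications $R_y:x\mapsto x*y$ are the permutations $$R_1=(3\;5)(4\;6),\quad R_2=(3\;6)(4\;5),\quad R_3=(1\;5)(2\;6),$$ $$R_4=(1\;6)(2\;5),\quad R_5=(1\;3)(2\;4),\quad R_6=(1\;4)(2\;3).$$ Then any non-zero idempotent of the integral quandle ring $\mathbb{Z}[X]$ is of one of the following three forms: $\alpha e_1+(1-\alpha)e_2$, $\beta e_3+(1-\beta)e_4$, $\gamma e_5+(1-\gamma)e_6$, where $\alpha,\beta,\gamma\in\mathbb{Z}$.
   Context: The integral quandle ring $\mathbb{Z}[X]$ is the free $\mathbb{Z}$-module with basis $\{e_x:x\in X\}$ and the bilinear (non-associative) product determined by $e_xe_y=e_{x*y}$, where $x*y=R_y(x)$. An idempotent is an element $u$ with $u^2=u$. *)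

(* Defs.v *)
From HB Require Import structures.
From mathcomp Require Import all_boot all_order all_algebra all_fingroup.

Set Implicit Arguments.
Unset Strict Implicit.
Unset Printing Implicit Defensive.

Import GRing.Theory.
Local Open Scope ring_scope.

Record finQuandle := FinQuandle {
  quandle_sort :> finType;
  quandle_op : quandle_sort -> quandle_sort -> quandle_sort;
  quandle_opxx : forall x, quandle_op x x = x;
  quandle_op_bij : forall y, bijective (quandle_op^~ y);
  quandle_op_dist : forall x y z,
    quandle_op (quandle_op x y) z = quandle_op (quandle_op x z) (quandle_op y z)
}.

Definition rightmul (X : finQuandle) (y : X) : {perm X} :=
  perm (bij_inj (quandle_op_bij y)).

Definition involutory (X : finQuandle) : Prop :=
  forall y : X, involutive (fun x => quandle_op x y).

Definition inner_group (X : finQuandle) : {group {perm X}} :=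
  <<[set rightmul y | y : X]>>%G.

Definition connected_quandle (X : finQuandle) : bool :=
  [transitive inner_group X, on [set: X] | 'P].

(* A fresh name for {ffun X -> int}, so that only its Z-module structure is
   inferred and not the pointwise product of functions. *)
Definition quandle_ring (X : finQuandle) : Type := {ffun X -> int}.

HB.instance Definition _ (X : finQuandle) :=
  GRing.Zmodule.copy (quandle_ring X) {ffun X -> int}.

Definition qbasis (X : finQuandle) (x : X) : quandle_ring X :=
  [ffun y => (y == x)%:R].

Definition qmul (X : finQuandle) (u v : quandle_ring X) : quandle_ring X :=
  \sum_(x : X) \sum_(y : X) qbasis (quandle_op x y) *~ (u x * v y).

Definition qidempotent (X : finQuandle) (u : quandle_ring X) : Prop :=
  qmul u u = u.

Section QuandleRingTheory.
Variable X : finQuandle.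
Implicit Types (u v w : quandle_ring X) (x y : X).

Lemma qring_coefMz u (a : int) x : (u *~ a) x = u x * a.
Proof.
have mulrnE n : (u *+ n) x = u x *+ n.
  by elim: n => [|n IHn]; rewrite ?mulr0n ?mulrS ffunE ?IHn.
by rewrite -mulrzz; case: a => n; rewrite ?NegzE ?mulrNz -?pmulrn ?ffunE mulrnE.
Qed.

Lemma qring_coef_sum (I : finType) (F : I -> quandle_ring X) x :
  (\sum_i F i) x = \sum_i F i x.
Proof. by apply: (big_morph (fun u => u x)) => [u v|]; rewrite ffunE. Qed.

Lemma qbasis_decomp u : u = \sum_x qbasis x *~ u x.
Proof.
apply/ffunP => z; rewrite qring_coef_sum (bigD1 z) //= qring_coefMz ffunE eqxx.
rewrite mul1r big1 ?addr0 // => x /negPf nxz.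
by rewrite qring_coefMz ffunE eq_sym nxz mul0r.
Qed.

Lemma qbasis_free (a : X -> int) :
  \sum_x qbasis x *~ a x = 0 -> forall x, a x = 0.
Proof.
move=> sum0 z; have := congr1 (fun u : quandle_ring X => u z) sum0.
rewrite qring_coef_sum (bigD1 z) //= qring_coefMz !ffunE eqxx mul1r.
rewrite big1 ?addr0 // => x /negPf nxz.
by rewrite qring_coefMz ffunE eq_sym nxz mul0r.
Qed.

Lemma qmul_basis x y : qmul (qbasis x) (qbasis y) = qbasis (quandle_op x y).
Proof.
rewrite /qmul (bigD1 x) //= (bigD1 y) //= !ffunE !eqxx mulr1 mulr1z.
rewrite !big1 ?addr0 // => [x' /negPf nx|y' /negPf ny].
  by rewrite big1 // => y' _; rewrite !ffunE nx mul0r mulr0z.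
by rewrite !ffunE ny mulr0 mulr0z.
Qed.

Lemma qmulDl u v w : qmul (u + v) w = qmul u w + qmul v w.
Proof.
rewrite /qmul -big_split; apply: eq_bigr => x _ /=.
rewrite -big_split; apply: eq_bigr => y _ /=.
by rewrite ffunE mulrDl mulrzDr.
Qed.

Lemma qmulDr u v w : qmul u (v + w) = qmul u v + qmul u w.
Proof.
rewrite /qmul -big_split; apply: eq_bigr => x _ /=.
rewrite -big_split; apply: eq_bigr => y _ /=.
by rewrite ffunE mulrDr mulrzDr.
Qed.

End QuandleRingTheory.

(* 'I_6 is {0, ..., 5}: the point k of {1, ..., 6} is the ordinal of value k - 1. *)
Definition p1 : 'I_6 := @Ordinal 6 0 isT.
Definition p2 : 'I_6 := @Ordinal 6 1 isT.
Definition p3 : 'I_6 := @Ordinal 6 2 isT.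
Definition p4 : 'I_6 := @Ordinal 6 3 isT.
Definition p5 : 'I_6 := @Ordinal 6 4 isT.
Definition p6 : 'I_6 := @Ordinal 6 5 isT.

Definition X6_R (y : 'I_6) : 'S_6 :=
  match val y with
  | 0 => tperm p3 p5 * tperm p4 p6
  | 1 => tperm p3 p6 * tperm p4 p5
  | 2 => tperm p1 p5 * tperm p2 p6
  | 3 => tperm p1 p6 * tperm p2 p5
  | 4 => tperm p1 p3 * tperm p2 p4
  | _ => tperm p1 p4 * tperm p2 p3
  end%g.

Definition X6_op (x y : 'I_6) : 'I_6 := X6_R y x.

Lemma I6_ind (P : 'I_6 -> Prop) :
  P p1 -> P p2 -> P p3 -> P p4 -> P p5 -> P p6 -> forall x, P x.
Proof.
move=> P1 P2 P3 P4 P5 P6 [m lt6].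
do 6![case: m lt6 => [|m] lt6; first by rewrite (bool_irrelevance lt6 isT)].
by [].
Qed.

Definition X6_table : seq (seq 'I_6) :=
  [:: [:: p1; p2; p5; p6; p3; p4]; [:: p1; p2; p6; p5; p4; p3];
      [:: p5; p6; p3; p4; p1; p2]; [:: p6; p5; p3; p4; p2; p1];
      [:: p3; p4; p1; p2; p5; p6]; [:: p4; p3; p2; p1; p5; p6]].

Lemma X6_opE x y : X6_op x y = nth p1 (nth [::] X6_table y) x.
Proof.
by elim/I6_ind: x; elim/I6_ind: y;
  rewrite /X6_op /X6_R /= permM !permE.
Qed.

Lemma X6_opxx x : X6_op x x = x.
Proof. by rewrite X6_opE; elim/I6_ind: x. Qed.

Lemma X6_op_bij y : bijective (X6_op^~ y).
Proof. by exists (X6_R y)^-1%g => x; rewrite /X6_op ?permK ?permKV. Qed.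

Lemma X6_op_dist x y z : X6_op (X6_op x y) z = X6_op (X6_op x z) (X6_op y z).
Proof.
by rewrite !X6_opE; elim/I6_ind: x; elim/I6_ind: y; elim/I6_ind: z.
Qed.

Definition X6 : finQuandle := FinQuandle X6_opxx X6_op_bij X6_op_dist.

Lemma X6_involutory : involutory X6.
Proof.
by move=> y x; rewrite /= !X6_opE; elim/I6_ind: x; elim/I6_ind: y.
Qed.

Lemma X6_rightmul (y : X6) : rightmul y = X6_R y.
Proof. by apply/permP => x; rewrite permE. Qed.

Lemma X6_connected : connected_quandle X6.
Proof.
have step (x y z : X6) : z \in orbit 'P (inner_group X6) x ->
    quandle_op z y \in orbit 'P (inner_group X6) x.
  move=> /orbitP[g gG <-]; apply/orbitP; exists (g * rightmul y)%g.
    by rewrite groupM // mem_gen // imset_f.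
  by rewrite actM /= /aperm permE.
apply/imsetP; exists (p1 : X6); first by rewrite inE.
apply/esym/setP => x; rewrite inE.
have m1 := orbit_refl 'P (inner_group X6) (p1 : X6).
have m5 := step _ (p3 : X6) _ m1.
have m6 := step _ (p4 : X6) _ m1.
have m3 := step _ (p5 : X6) _ m1.
have m4 := step _ (p6 : X6) _ m1.
have m2 := step _ (p4 : X6) _ m5.
move: m1 m2 m3 m4 m5 m6; rewrite /= !X6_opE /=.
by elim/I6_ind: x.
Qed.

(* Main.v *)
Require Import Defs.
From mathcomp Require Import all_boot all_order all_algebra all_fingroup.
From mathcomp Require Import zify.
Import GRing.Theory.
Local Open Scope ring_scope.

(** The pairs {1,2}, {3,4}, {5,6} are the fibres of a quandle morphism from
    [X6] onto the three-element dihedral quandle, in which [x * y] is the third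
    point when [x] and [y] differ.  On each fibre take the sum and the
    difference of the two coefficients of [u]: sums [A], [B], [C] and
    differences [a], [b], [c].  In these coordinates [u * u = u] splits into
      - [A = A^2 + 2BC] and its cyclic images: the sums are the coefficients of
        the image of [u] in the ring of the dihedral quandle, hence form an
        idempotent there;
      - [a = aA + 2bc] and its cyclic images.

    The first system has only the integer solutions 0 and the three unit
    vectors ([dihedral3_idempotent]).  If the sums vanish, then [a = 2bc],
    [b = 2ac], [c = 2ab], whence [a = 4ab^2]; as [4b^2 <> 1] over the integers,
    all the differences vanish ([differences_eq0]) and [u = 0].  If the sums
    are a unit vector, say [A = 1] and [B = C = 0], then [bc = 0], which forces
    [b = c = 0] ([two_differences_eq0]): [u] is supported on the first fibre,
    with coefficients of sum 1 and [a] arbitrary. *)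

(** Right multiplications being involutions, [x * y = z] holds exactly when
    [x = z * y]: one index of the double sum is determined by the other. *)
Lemma qmul_coef (X : finQuandle) (u v : quandle_ring X) (z : X) :
  involutory X -> qmul u v z = \sum_y u (quandle_op z y) * v y.
Proof.
move=> invX; rewrite /qmul exchange_big qring_coef_sum; apply: eq_bigr => y _.
rewrite qring_coef_sum (bigD1 (quandle_op z y)) //= qring_coefMz ffunE.
rewrite invX eqxx mul1r big1 ?addr0 // => x nxz; rewrite qring_coefMz ffunE.
case: eqP => [zE|_]; last by rewrite mul0r.
by case/eqP: nxz; rewrite zE invX.
Qed.

Lemma X6_sum (F : X6 -> int) :
  \sum_x F x = F p1 + F p2 + F p3 + F p4 + F p5 + F p6.
Proof.
rewrite !big_ord_recl big_ord0 addr0 !addrA.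
by do ![congr (_ + _)]; congr F; apply: val_inj.
Qed.

(** Subtracting two of the equations leaves [(A - B)(A + B - 2C - 1) = 0] and
    its cyclic images.  If [A], [B], [C] were distinct, the linear factors would
    all vanish, and subtracting them gives [B = C].  So two of the unknowns
    agree, and the third either agrees with them or exceeds them by 1.  The common
    value [t] then satisfies [t(3t - 1) = 0] or [t(3t + 1) = 0], whose only
    integer solution is 0. *)
Lemma dihedral3_idempotent (A B C : int) :
    A = A * A + 2 * (B * C) -> B = B * B + 2 * (A * C) ->
    C = C * C + 2 * (A * B) ->
  [\/ [/\ A = 0, B = 0 & C = 0], [/\ A = 1, B = 0 & C = 0],
      [/\ A = 0, B = 1 & C = 0] | [/\ A = 0, B = 0 & C = 1]].
Proof.
move=> eA eB eC.
have diffM (x y z : int) : x = x * x + 2 * (y * z) ->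
    y = y * y + 2 * (x * z) -> x = y \/ x + y = 2 * z + 1.
  move=> ex ey; have /eqP : (x - y) * (x + y - (2 * z + 1)) = 0 by lia.
  by rewrite mulf_eq0 !subr_eq0 => /orP[] /eqP; [left | right].
have rootE (t s : int) : t * (3 * t + s) = 0 -> `|s| = 1 -> t = 0.
  by move=> /eqP; rewrite mulf_eq0 => /orP[] /eqP; lia.
have AB := diffM _ _ _ eA eB.
have AC : A = C \/ A + C = 2 * B + 1 by apply: diffM; lia.
case: AB => [eAB | AB].
  subst B; case: AC => [eAC | AC].
    have A0 : A = 0 by apply: (rootE A (- 1)); lia.
    by constructor 1; split; lia.
  have eC1 : C = A + 1 by lia.
  have A0 : A = 0 by apply: (rootE A 1) => //; subst C; lia.
  by constructor 4; split; lia.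
case: AC => [eAC | AC].
  have eB1 : B = A + 1 by lia.
  have A0 : A = 0 by apply: (rootE A 1) => //; subst C B; lia.
  by constructor 3; split; lia.
have eA1 : A = B + 1 by lia.
have eCB : C = B by lia.
have B0 : B = 0 by apply: (rootE B 1) => //; subst C A; lia.
by constructor 2; split; lia.
Qed.

(** Integrality is essential: [a = b = c = 1/2] is a rational solution. *)
Lemma differences_eq0 (a b c : int) :
    a = 2 * (b * c) -> b = 2 * (a * c) -> c = 2 * (a * b) ->
  [/\ a = 0, b = 0 & c = 0].
Proof.
move=> ea eb ec.
have a0 : a = 0.
  have /eqP : a * (1 - 4 * (b * b)) = 0.
    by have := ea; rewrite ec; lia.
  by rewrite mulf_eq0 => /orP[/eqP // | /eqP]; nia.
by rewrite eb ec a0 !mul0r.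
Qed.

Lemma two_differences_eq0 (a b c : int) :
  b * c = 0 -> b = 2 * (a * c) -> c = 2 * (a * b) -> b = 0 /\ c = 0.
Proof.
move=> /eqP; rewrite mulf_eq0 => /orP[] /eqP -> eb ec; split=> //.
  by rewrite ec !mulr0.
by rewrite eb !mulr0.
Qed.

Theorem proposition6p2 (u : quandle_ring X6) (u_neq0 : u != 0)
    (u_idem : qidempotent u) :
  [\/ exists alpha : int, u = @qbasis X6 p1 *~ alpha + @qbasis X6 p2 *~ (1 - alpha),
      exists beta : int, u = @qbasis X6 p3 *~ beta + @qbasis X6 p4 *~ (1 - beta)
    | exists gamma : int, u = @qbasis X6 p5 *~ gamma + @qbasis X6 p6 *~ (1 - gamma)].
Proof.
(* The coefficients are read through an abstract function, so that all
   occurrences of each of them are the same atom for linear arithmetic. *)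
have [f fE] : exists f : 'I_6 -> int, forall x : X6, u x = f x by exists u.
have coefE (z : X6) : f z = \sum_(y : X6) f (quandle_op z y) * f y.
  under eq_bigr do rewrite -!fE.
  by rewrite -fE -qmul_coef ?u_idem //; exact: X6_involutory.
have e1 := coefE p1; have e2 := coefE p2; have e3 := coefE p3.
have e4 := coefE p4; have e5 := coefE p5; have e6 := coefE p6.
rewrite !X6_sum /= !X6_opE /= in e1 e2 e3 e4 e5 e6.
pose A : int := f p1 + f p2; pose a : int := f p1 - f p2.
pose B : int := f p3 + f p4; pose b : int := f p3 - f p4.
pose C : int := f p5 + f p6; pose c : int := f p5 - f p6.
have eA : A = A * A + 2 * (B * C) by rewrite /A /B /C; lia.
have eB : B = B * B + 2 * (A * C) by rewrite /A /B /C; lia.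
have eC : C = C * C + 2 * (A * B) by rewrite /A /B /C; lia.
have ea : a = a * A + 2 * (b * c) by rewrite /A /a /b /c; lia.
have eb : b = b * B + 2 * (a * c) by rewrite /B /a /b /c; lia.
have ec : c = c * C + 2 * (a * b) by rewrite /C /a /b /c; lia.
have [[A0 B0 C0] | [A1 B0 C0] | [A0 B1 C0] | [A0 B0 C1]] :=
  dihedral3_idempotent _ _ _ eA eB eC.
- have [a0 b0 c0] : [/\ a = 0, b = 0 & c = 0].
    by apply: differences_eq0; rewrite ?A0 ?B0 ?C0 ?mulr0 ?add0r in ea eb ec.
  rewrite /A /B /C /a /b /c in A0 B0 C0 a0 b0 c0.
  case/eqP: u_neq0; apply/ffunP; elim/I6_ind; rewrite fE ffunE; lia.
- have [b0 c0] : b = 0 /\ c = 0.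
    rewrite A1 in ea; rewrite B0 in eb; rewrite C0 in ec.
    by apply: (two_differences_eq0 a); lia.
  constructor 1; exists (f p1); rewrite /A /B /C /b /c in A1 B0 C0 b0 c0.
  by apply/ffunP; elim/I6_ind; rewrite fE ffunE !qring_coefMz !ffunE /=; lia.
- have [a0 c0] : a = 0 /\ c = 0.
    rewrite B1 in eb; rewrite A0 in ea; rewrite C0 in ec.
    by apply: (two_differences_eq0 b); lia.
  constructor 2; exists (f p3); rewrite /A /B /C /a /c in A0 B1 C0 a0 c0.
  by apply/ffunP; elim/I6_ind; rewrite fE ffunE !qring_coefMz !ffunE /=; lia.
- have [a0 b0] : a = 0 /\ b = 0.
    rewrite C1 in ec; rewrite A0 in ea; rewrite B0 in eb.
    by apply: (two_differences_eq0 c); lia.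
  constructor 3; exists (f p5); rewrite /A /B /C /a /b in A0 B0 C1 a0 b0.
  by apply/ffunP; elim/I6_ind; rewrite fE ffunE !qring_coefMz !ffunE /=; lia.
Qed.
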